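(* Let $G$ be a topological group, let $H$ be a locally compact subgroup of $G$, and let $G/H$ be the quotient space of left cosets with the quotient topology. (1) If $G/H$ is weakly compact-bounded, then $G$ is locally weakly compact-bounded. (2) If $G/H$ is compact-bounded, then $G$ is locally compact-bounded.
   Context: All topological spaces (in particular all topological groups) are assumed to be Hausdorff. A space $X$ is compact-bounded if for every countable family $\mathcal U$ of non-empty open subsets of $X$ there is a compact $K\subset X$ which meets each element of $\mathcal U$. A space $X$ is weakly compact-bounded if for every infinite countable family $\mathcal U$ of non-empty open subsets of $X$ there is a compact $K\subset X$ which meets infinitely many elements of $\mathcal U$. A topological group is locally (weakly) compact-bounded if every point (equivalently, the neutral element) has a neighborhood which, as a subspace, is (weakly) compact-bounded. *)

(* Defs.v *)
From HB Require Import structures.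
From mathcomp Require Import all_boot all_order all_algebra.
From mathcomp Require Import all_classical.
From mathcomp Require Import topology.

Set Implicit Arguments.
Unset Strict Implicit.
Unset Printing Implicit Defensive.

Local Open Scope classical_set_scope.
Local Open Scope quotient_scope.
Local Open Scope group_scope.

HB.mixin Record Group_isTopologicalGroup G & Topological G & Group G := {
  mulg_continuous : continuous (fun x : G * G => x.1 * x.2) ;
  invg_continuous : continuous (fun x : G => x^-1)
}.

(* Hausdorffness is not part of the structure: it is assumed separately, as
   [hausdorff_space G]. *)
#[short(type="topologicalGroupType")]
HB.structure Definition TopologicalGroup :=
  {G of Topological G & Group G & Group_isTopologicalGroup G}.

Section LeftCosets.
Variables (G : groupType) (H : groupClosed G).

(* x H = y H *)
Definition left_coset_rel : rel G := fun x y => x^-1 * y \in H.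

Lemma left_coset_rel_refl : reflexive left_coset_rel.
Proof. by move=> x; rewrite /left_coset_rel mulVg gpred1. Qed.

Lemma left_coset_rel_sym : symmetric left_coset_rel.
Proof. by move=> x y; rewrite /left_coset_rel -gpredV invgM invgK. Qed.

Lemma left_coset_rel_trans : transitive left_coset_rel.
Proof.
move=> y x z xy yz; rewrite /left_coset_rel.
have -> : x^-1 * z = (x^-1 * y) * (y^-1 * z) by rewrite -mulgA mulVKg.
exact: gpredM.
Qed.

Canonical left_coset_equiv :=
  EquivRel left_coset_rel
    left_coset_rel_refl left_coset_rel_sym left_coset_rel_trans.

End LeftCosets.

Definition left_coset_space (G : topologicalGroupType) (H : groupClosed G) :
    topologicalType :=
  quotient_topology {eq_quot (left_coset_equiv H)}.

Definition compact_bounded (X : topologicalType) : Prop :=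
  forall U : set (set X), countable U ->
    (forall A, U A -> open A /\ A !=set0) ->
    exists K : set X, compact K /\ forall A, U A -> K `&` A !=set0.

Definition weakly_compact_bounded (X : topologicalType) : Prop :=
  forall U : set (set X), infinite_set U -> countable U ->
    (forall A, U A -> open A /\ A !=set0) ->
    exists K : set X, compact K /\
      infinite_set [set A | U A /\ K `&` A !=set0].

(* [set_type V] is the subset V with the topology induced by X. *)
Definition locally_compact_bounded (X : topologicalType) : Prop :=
  forall x : X, exists2 V : set X, nbhs x V & compact_bounded (set_type V).

Definition locally_weakly_compact_bounded (X : topologicalType) : Prop :=
  forall x : X,
    exists2 V : set X, nbhs x V & weakly_compact_bounded (set_type V).

(* The library's [locally_compact A], for a subset A of X, asks for
   compactness in the ambient X and is weaker than local compactness of A as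
   a space (it holds for the rationals in the reals); hence the subgroup is
   turned into a space of its own. *)
Definition locally_compact_subgroup (G : topologicalGroupType)
    (H : groupClosed G) : Prop :=
  locally_compact [set: set_type [set x : G | x \in H]].

(* Main.v *)
(** If [W] is a neighbourhood of [1] whose trace on [H] lies in a compact subset
    of [H], and [V] is a closed neighbourhood of a point with [V^-1 V] inside [W]
    (and a little room to spare), then [V] meets every coset [gH] that comes
    close to it in a subset of a compact translate.  Hence the projection
    restricted to [V] is perfect: [V] meets the preimage of a compact set of
    cosets in a compact set.  Since the projection is open, a family of open
    subsets of [V] is sent to a family of open sets of cosets; a compact set
    meeting the latter lifts to a compact subset of [V] meeting the former. *)
Require Import Defs.
From HB Require Import structures.
From mathcomp Require Import all_boot all_order all_algebra.
From mathcomp Require Import all_classical.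
From mathcomp Require Import topology.

Set Implicit Arguments.
Unset Strict Implicit.
Unset Printing Implicit Defensive.

Local Open Scope classical_set_scope.
Local Open Scope group_scope.

(** A filter on [V] is pushed forward to [X]; its cluster point in [A] lies in [V], where open sets
    are traces of open sets of [X]. *)
Lemma compact_set_val_preimage (X : topologicalType) (V A : set X) :
  A `<=` V -> compact A -> compact (set_val @^-1` A : set (set_type V)).
Proof.
move=> AV Acpt F PF FA.
have [y [Ay cly]] := Acpt (set_val @ F) _ FA.
have yV : y \in V by rewrite inE; exact: AV.
exists (SigSub yV : set_type V); split=> // B C FB [_ [[W oW <-] /= Wy] WC].
have FBy : (set_val @ F) (set_val @` B).
  by apply: (@filterS _ F _ B _ _ FB); exact: preimage_image.
have [_ [[b Bb <-] Wb]] := cly _ _ FBy (open_nbhs_nbhs (conj oW Wy)).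
by exists b; split=> //; exact: WC.
Qed.

(** * Transfer of boundedness through a map on open sets *)

Section CompactBoundedTransfer.
Variables (X Y : topologicalType) (t : set X -> set Y).
Hypothesis t_open : forall O, open O -> O !=set0 -> open (t O) /\ t O !=set0.
Hypothesis t_lift : forall K, compact K -> exists2 L : set X, compact L &
  forall O, K `&` t O !=set0 -> L `&` O !=set0.

Let image_family (U : set (set X)) : (forall O, U O -> open O /\ O !=set0) ->
  forall A, (t @` U) A -> open A /\ A !=set0.
Proof. by move=> Uop _ [O /Uop [? ?] <-]; exact: t_open. Qed.

Lemma compact_bounded_transfer : compact_bounded Y -> compact_bounded X.
Proof.
move=> Ybd U cU Uop.
have [K [Kcpt KU]] := Ybd _ (sub_countable (card_image_le t U) cU)
  (image_family Uop).
have [L Lcpt KL] := t_lift Kcpt.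
by exists L; split=> // O UO; apply/KL/KU; exists O.
Qed.

(* Distinct open sets may have the same image; if only finitely many images
   occur, then a finite set meets all of them. *)
Lemma weakly_compact_bounded_transfer :
  weakly_compact_bounded Y -> weakly_compact_bounded X.
Proof.
move=> Ybd U infU cU Uop.
have [fintU|inftU] := pselect (finite_set (t @` U)).
  have [O0 UO0] := infinite_setN0 infU.
  have [y0 _] : t O0 !=set0 by have [_] := image_family Uop (imageP t UO0).
  (* One point is chosen in each of the finitely many images; [y0] is only the default value of
     [xget]. *)
  have [L Lcpt KL] := t_lift (finite_compact (finite_image (xget y0) fintU)).
  exists L; split=> //.
  suff -> : [set O | U O /\ L `&` O !=set0] = U by [].
  apply/seteqP; split=> [O []//|O UO]; split=> //; apply: KL.
  have [y tOy] : t O !=set0 by have [_] := image_family Uop (imageP t UO).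
  exists (xget y0 (t O)); split; last exact: xgetI tOy.
  by exists (t O) => //; exists O.
have [K [Kcpt KU]] := Ybd _ inftU (sub_countable (card_image_le t U) cU)
  (image_family Uop).
have [L Lcpt KL] := t_lift Kcpt.
exists L; split=> // fin; apply: KU.
apply: sub_finite_set (finite_image t fin).
by move=> _ [[O UO <-] KO]; exists O => //; split=> //; exact: KL.
Qed.

End CompactBoundedTransfer.

(** * Limits and regularity in topological groups *)

Section GroupLimits.
Variable G : topologicalGroupType.

Lemma cvgMg (T : Type) (F : set_system T) (FF : Filter F) (f g : T -> G)
    (a b : G) :
  f @ F --> a -> g @ F --> b -> (f x * g x) @[x --> F] --> a * b.
Proof.
by move=> fa gb; apply: continuous2_cvg fa gb; exact: (mulg_continuous (a, b)).
Qed.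

Lemma cvgVg (T : Type) (F : set_system T) (FF : Filter F) (f : T -> G) (a : G) :
  f @ F --> a -> (f x)^-1 @[x --> F] --> a^-1.
Proof. by move=> fa; apply: continuous_cvg fa; exact: invg_continuous. Qed.

Lemma mulgr_continuous (b : G) : continuous (fun x : G => x * b).
Proof. by move=> x; apply: cvgMg; [exact: cvg_id|exact: cvg_cst]. Qed.

Lemma nbhs_divl (x : G) (V : set G) : nbhs x V ->
  exists N U : set G, [/\ nbhs 1 N, nbhs x U &
    forall n y, N n -> U y -> V (n^-1 * y)].
Proof.
move=> xV.
have : (fun p : G * G => p.1^-1 * p.2) @ (1, x) --> x.
  rewrite -[X in _ --> X](mulKg 1) mul1g.
  by apply: cvgMg; [apply: cvgVg; exact: cvg_fst|exact: cvg_snd].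
by move=> /(_ _ xV) [[N U] /= [N1 Ux] NUV]; exists N, U; split=> // n y Nn Uy;
  exact: (NUV (n, y)).
Qed.

(** If [z] is in the closure of [U], then [N z] meets [U] in some [y = n z], and [z = n^-1 y] lies
    in [V]. *)
Lemma topological_group_regular (x : G) (V : set G) : nbhs x V ->
  exists2 U : set G, open_nbhs x U & closure U `<=` V.
Proof.
move=> /nbhs_divl [N [U [N1 Ux NUV]]].
exists U°.
  by split; [exact: open_interior|exact: nbhs_singleton (nbhs_interior Ux)].
move=> z clUz.
have zN : nbhs z ((fun y : G => y * z^-1) @^-1` N).
  by apply: mulgr_continuous; rewrite mulgV.
have [y [/interior_subset Uy Ny]] := clUz _ zN.
by have := NUV _ _ Ny Uy; rewrite invgM invgK mulgVK.
Qed.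

End GroupLimits.

(** * The projection onto left cosets *)

Section CosetProjection.
Variables (G : topologicalGroupType) (H : groupClosed G).

Let q : G -> left_coset_space H := \pi_(left_coset_space H)%qT.

Lemma coset_eqP (x y : G) : q x = q y <-> x^-1 * y \in H.
Proof. by split=> [/eqmodP|xyH]; [|apply/eqmodP]. Qed.

(** The saturation of [O] is the union of its open translates [O h^-1] with [h] in [H]. *)
Lemma coset_open (O : set G) : open O -> open (q @` O).
Proof.
move=> oO; rewrite /open /= /quotient_open.
have -> : \pi_(left_coset_space H)%qT @^-1` (q @` O) =
    \bigcup_(h in [set h | h \in H]) ((fun y : G => y * h) @^-1` O).
  apply/seteqP; split=> [y [z Oz /esym/coset_eqP yzH]|y [h /= hH Oyh]].
    by exists (y^-1 * z) => //=; rewrite mulVKg.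
  by exists (y * h) => //; apply/esym/coset_eqP; rewrite mulKg.
apply: bigcup_open => h _; apply: open_comp oO => y _.
exact: mulgr_continuous.
Qed.

(** [C] is a compact neighbourhood of [1] in [H], viewed in [G]; [W] is an open set of [G] whose
    trace on [H] lies in it. *)
Lemma locally_compact_subgroup_nbhs1 : locally_compact_subgroup H ->
  exists W C : set G, [/\ nbhs 1 W, compact C,
    forall c, C c -> c \in H & forall h, W h -> h \in H -> C h].
Proof.
have H1 : 1 \in [set x : G | x \in H] by rewrite inE /=; exact: gpred1.
move=> /(_ (SigSub H1 : set_type [set x : G | x \in H]) I) [C].
move=> + [Ccpt _]; rewrite withinET => -[_ [[W oW <-] /= W1] WC].
exists W, (set_val @` C); split.
- exact: open_nbhs_nbhs.
- apply: continuous_compact Ccpt.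
  by apply: continuous_subspaceT; exact: initial_continuous.
- by move=> _ [c _ <-]; have := set_valP c.
- move=> h Wh hH; have hH' : h \in [set x : G | x \in H] by rewrite inE.
  by exists (SigSub hH' : set_type [set x : G | x \in H]) => //; exact: WC.
Qed.

(* The representative [g] of a coset in the cluster set of [F] may be far from
   [V]: it has to be moved along its coset first. *)
Lemma coset_perfect_nbhs (x : G) : locally_compact_subgroup H ->
  exists2 U : set G, open_nbhs x U &
    forall K, compact K -> compact (closure U `&` q @^-1` K).
Proof.
move=> /locally_compact_subgroup_nbhs1 [W [C [W1 Ccpt CH WC]]].
have [V xV VW] : exists2 V : set G, nbhs x V &
    forall y z, V y -> V z -> W (y^-1 * z).
  have : (fun p : G * G => p.1^-1 * p.2) @ (x, x) --> (1 : G).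
    rewrite -[X in _ --> X](mulVg x).
    by apply: cvgMg; [apply: cvgVg; exact: cvg_fst|exact: cvg_snd].
  move=> /(_ _ W1) [[A B] /= [Ax Bx] AB].
  exists (A `&` B); first exact: filterI.
  by move=> y z [Ay _] [_ Bz]; exact: (AB (y, z)).
have [N [V' [N1 V'x NV']]] := nbhs_divl xV.
have [U xU UV'] := topological_group_regular V'x.
exists U => // K Kcpt F PF FUK.
have FU : F (closure U) by apply: filterS FUK; exact: subIsetl.
have FqK : (q @ F) K.
  by apply: (@filterS _ F _ _ (q @^-1` K) _ FUK); exact: subIsetr.
have [p [Kp clp]] := Kcpt _ _ FqK.
have meet g A M : q g = p -> F A -> nbhs 1 M ->
    exists n h, [/\ M n, h \in H & A (n * g * h)].
  move=> qg FA M1.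
  have Mg : nbhs g ((fun y : G => y * g^-1) @^-1` M).
    by apply: mulgr_continuous; rewrite mulgV.
  have Mp : nbhs p (q @` ((fun y : G => y * g^-1) @^-1` M)°).
    apply: open_nbhs_nbhs; split.
      by apply: coset_open; exact: open_interior.
    by exists g => //; exact: nbhs_singleton (nbhs_interior Mg).
  have FqA : (q @ F) (q @` A).
    by apply: (@filterS _ F _ A _ _ FA); exact: preimage_image.
  have [_ [[a Aa <-] [b /interior_subset Mb /coset_eqP baH]]] := clp _ _ FqA Mp.
  exists (b * g^-1), (b^-1 * a); split=> //.
  by rewrite mulgVK mulVKg.
have [g [qg gV]] : exists g, q g = p /\ V g.
  have [n [h [Nn hH Unh]]] := meet (repr p) _ _ (reprK p) FU N1.
  exists (repr p * h); split.
    rewrite -[RHS]reprK; apply/coset_eqP.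
    by rewrite invgM mulgVK gpredV.
  by have := NV' _ _ Nn (UV' _ Unh); rewrite -mulgA mulKg.
(* The filter is transported to [H]: [S (A, M)] collects the [h] for which [A] meets [M g h]. *)
pose S (i : set G * set G) :=
  [set h | h \in H /\ exists2 n, i.2 n & i.1 (n * g * h)].
pose D (i : set G * set G) := F i.1 /\ nbhs 1 i.2.
have SF : ProperFilter (filter_from D S).
  apply: filter_from_proper.
    apply: filter_from_filter.
      by exists (setT, setT); split; exact: filterT.
    move=> [A M] [A' M'] [/= FA M1] [/= FA' M1'].
    exists (A `&` A', M `&` M'); first by split; exact: filterI.
    by move=> h [hH [n [Mn M'n] [Ah A'h]]]; split; split=> //; exists n.
  move=> [A M] [/= FA M1].
  have [n [h [Mn hH Anh]]] := meet _ _ _ qg FA M1.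
  by exists h; split=> //; exists n.
(* If [n g h] is in [closure U] with [n] in [N], then [g h] is in [V], as is [g], so
   [h = g^-1 (g h)] is in [W]. *)
have SC : filter_from D S C.
  exists (closure U, N) => // h [hH [n /= Nn Unh]].
  apply: WC hH.
  have := VW _ _ gV (NV' _ _ Nn (UV' _ Unh)).
  by rewrite -mulgA mulKg mulKg.
have [c [Cc clc]] := Ccpt _ SF SC.
(* Points [n g h] of [A] approach [g c] as [n] tends to [1] and [h] comes near [c]. *)
have clF : cluster F (g * c).
  move=> A B FA gcB.
  have : (fun p : G * G => p.1 * g * p.2) @ (1, c) --> g * c.
    rewrite -[X in X * c]mul1g.
    apply: cvgMg; last exact: cvg_snd.
    by apply: cvgMg; [exact: cvg_fst|exact: cvg_cst].
  move=> /(_ _ gcB) [[M L] /= [M1 Lc] MLB].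
  have FS : filter_from D S (S (A, M)) by exists (A, M).
  have [h [[hH [n /= Mn Anh]] Lh]] := clc _ _ FS Lc.
  by exists (n * g * h); split=> //; exact: (MLB (n, h)).
exists (g * c); split=> //; split.
  by apply: closed_closure => B; exact: clF.
have gcp : q (g * c) = p.
  by rewrite -qg; apply/esym/coset_eqP; rewrite mulKg; exact: CH.
by rewrite -[_ (g * c)]/(K (q (g * c))) gcp.
Qed.

End CosetProjection.


(** * Boundedness of the closure of [U] *)

Section LocalTransfer.
Variables (G : topologicalGroupType) (H : groupClosed G) (U : set G).
Hypothesis oU : open U.

Let q : G -> left_coset_space H := \pi_(left_coset_space H)%qT.

Hypothesis Ucpt : forall K, compact K -> compact (closure U `&` q @^-1` K).

(** [O] is cut down to [U] because an open subset of [closure U] need not be open in [G]. *)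
Let t (O : set (set_type (closure U))) := q @` (set_val @` O `&` U).

Let t_open O : open O -> O !=set0 -> open (t O) /\ t O !=set0.
Proof.
move=> [W oW <-] [[z zU] /= Wz]; split.
  apply: coset_open.
  suff -> : set_val @` (set_val @^-1` W : set (set_type (closure U))) `&` U
    = W `&` U by exact: openI.
  apply/seteqP; split=> [y [[v Wv <-] Uv]|y [Wy Uy]]; first by split.
  split=> //; have yU : y \in closure U by rewrite inE; exact: subset_closure.
  by exists (SigSub yU : set_type (closure U)).
(* [z] may lie outside [U], but its neighbourhood [W] meets [U]. *)
have zcl : closure U z := set_mem zU.
have [y [Uy Wy]] := zcl _ (open_nbhs_nbhs (conj oW Wz)).
have yU : y \in closure U by rewrite inE; exact: subset_closure.
by exists (q y), y => //; split=> //; exists (SigSub yU : set_type (closure U)).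
Qed.

Let t_lift K : compact K -> exists2 L, compact L &
  forall O, K `&` t O !=set0 -> L `&` O !=set0.
Proof.
move=> /Ucpt UKcpt.
exists (set_val @^-1` (closure U `&` q @^-1` K) : set (set_type (closure U))).
  by apply: compact_set_val_preimage UKcpt; exact: subIsetl.
move=> O [_ [/[swap] -[_ [[v Ov <-] _] <-] Kv]].
by exists v; split=> //; split=> //; exact: set_valP.
Qed.

Lemma compact_bounded_closure :
  compact_bounded (left_coset_space H) ->
  compact_bounded (set_type (closure U)).
Proof. exact: compact_bounded_transfer t_open t_lift. Qed.

Lemma weakly_compact_bounded_closure :
  weakly_compact_bounded (left_coset_space H) ->
  weakly_compact_bounded (set_type (closure U)).
Proof. exact: weakly_compact_bounded_transfer t_open t_lift. Qed.

End LocalTransfer.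

Theorem proposition4p4 (G : topologicalGroupType) (H : groupClosed G) :
  hausdorff_space G ->
  locally_compact_subgroup H ->
  (weakly_compact_bounded (left_coset_space H) ->
     locally_weakly_compact_bounded G) /\
  (compact_bounded (left_coset_space H) ->
     locally_compact_bounded G).
Proof.
move=> _ lcH; split=> bd x; have [U oUx Ucpt] := coset_perfect_nbhs x lcH;
  have [oU _] := oUx; exists (closure U).
- by apply: filterS (open_nbhs_nbhs oUx); exact: subset_closure.
- exact: weakly_compact_bounded_closure oU Ucpt bd.
- by apply: filterS (open_nbhs_nbhs oUx); exact: subset_closure.
- exact: compact_bounded_closure oU Ucpt bd.
Qed.
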